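(* Let $\psi\colon G\to H$ be an epimorphism of commutative groups and let $h\colon R\to S$ be a morphism of $G$-graded commutative rings. Then $h$ is an epimorphism in the category of $G$-graded (commutative) rings if and only if the $\psi$-coarsening $h_{[\psi]}\colon R_{[\psi]}\to S_{[\psi]}$ is an epimorphism in the category of $H$-graded (commutative) rings.
   Context: All groups and rings are commutative (rings unital). Morphisms of graded rings are degree-preserving ring homomorphisms. For a $G$-graded ring $R$, its $\psi$-coarsening $R_{[\psi]}$ is the $H$-graded ring with the same underlying ring as $R$ and with $(R_{[\psi]})_{k}=\bigoplus_{g\in\psi^{-1}(k)}R_g$ for $k\in H$. For a morphism $h$ of $G$-graded rings, $h_{[\psi]}$ is the same underlying map viewed as a morphism of $H$-graded rings. *)

(* Defs.v *)
From mathcomp Require Import all_boot all_algebra.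
From mathcomp Require Import boolp.
Set Implicit Arguments.
Unset Strict Implicit.
Unset Printing Implicit Defensive.
Import GRing.Theory.
Local Open Scope ring_scope.

(* Commutative groups are written additively, as terms of zmodType.           *)
(* Rings are comPzRingType, so that the zero ring is allowed.                 *)

(* Epimorphisms in the category of commutative groups. *)
Definition group_epi (G H : zmodType) (psi : {additive G -> H}) : Prop :=
  forall (K : zmodType) (u v : {additive H -> K}),
    u \o psi =1 v \o psi -> u =1 v.

(* The set of finite sums of elements of the A i with i in P. *)
Definition sum_of (I : choiceType) (V : zmodType) (P : pred I)
    (A : I -> {pred V}) : {pred V} :=
  fun x => `[< exists (s : seq I) (f : I -> V),
      [/\ uniq s, {in s, forall i, P i /\ f i \in A i}
        & x = \sum_(i <- s) f i] >].

Definition independent (I : choiceType) (V : zmodType)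
    (A : I -> {pred V}) : Prop :=
  forall (s : seq I) (f : I -> V),
    uniq s -> {in s, forall i, f i \in A i} ->
    \sum_(i <- s) f i = 0 -> {in s, forall i, f i = 0}.

(* There is no axiom 1 \in component 0: it follows from the other ones. *)
Record gradedRing (G : zmodType) := GradedRing {
  graded_ring :> comPzRingType;
  component : G -> {pred graded_ring};
  component_zmod : forall g, zmod_closed (component g);
  component_sum : forall x, x \in sum_of predT component;
  component_indep : independent component;
  component_mul : forall (g g' : G) (x y : graded_ring),
    x \in component g -> y \in component g' -> x * y \in component (g + g')
}.

Record gradedHom (G : zmodType) (R S : gradedRing G) := GradedHom {
  graded_rmorphism :> {rmorphism R -> S};
  graded_homP : forall (g : G) (x : R),
    x \in component g -> graded_rmorphism x \in component g
}.

(* Epimorphisms in the category of G-graded rings. *)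
Definition graded_epi (G : zmodType) (R S : gradedRing G)
    (h : gradedHom R S) : Prop :=
  forall (T : gradedRing G) (u v : gradedHom S T), u \o h =1 v \o h -> u =1 v.

Section SumOf.
Variables (I : choiceType) (V : zmodType) (A : I -> {pred V}).
Hypothesis A_zmod : forall i, zmod_closed (A i).

Lemma sum_ofP (P : pred I) x :
  reflect (exists (s : seq I) (f : I -> V),
    [/\ uniq s, {in s, forall i, P i /\ f i \in A i}
      & x = \sum_(i <- s) f i]) (x \in sum_of P A).
Proof. exact: asboolP. Qed.

Lemma sum_widen (s u : seq I) (f : I -> V) : uniq s -> uniq u ->
  {subset s <= u} ->
  \sum_(i <- u) (if i \in s then f i else 0) = \sum_(i <- s) f i.
Proof.
move=> us uu su; rewrite -big_mkcond -big_filter; apply: perm_big.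
apply: uniq_perm => //; first exact: filter_uniq.
by move=> i; rewrite mem_filter andb_idr // => /su.
Qed.

Lemma sum_of_zmod (P : pred I) : zmod_closed (sum_of P A).
Proof.
split; first by apply/sum_ofP; exists [::], (fun=> 0); rewrite big_nil; split.
move=> x y /sum_ofP[s [f [us fs ->]]] /sum_ofP[t [g [ut gt ->]]].
apply/sum_ofP; exists (undup (s ++ t)),
  (fun i => (if i \in s then f i else 0) - (if i \in t then g i else 0)).
split; first exact: undup_uniq.
- move=> i; rewrite mem_undup mem_cat => ist; split.
    by case/orP: ist => [/fs[]|/gt[]].
  have [A0 AB] := A_zmod i; apply: AB.
  + by case: ifP => [/fs[]|].
  + by case: ifP => [/gt[]|].
- rewrite sumrB !sum_widen ?undup_uniq // => i; rewrite mem_undup mem_cat => ->//.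
  by rewrite orbT.
Qed.

Lemma zmod_closed_sum (B : {pred V}) (J : eqType) (s : seq J) (f : J -> V) :
  zmod_closed B -> {in s, forall j, f j \in B} -> \sum_(j <- s) f j \in B.
Proof.
move=> [B0 BB]; have BD x y : x \in B -> y \in B -> x + y \in B.
  by move=> Bx By; rewrite -[y]opprK; apply: (BB) => //; rewrite -sub0r; apply: BB.
by move=> fB; rewrite big_seq; elim/big_ind: _.
Qed.

Lemma sum_of1 (P : pred I) i x : P i -> x \in A i -> x \in sum_of P A.
Proof.
move=> Pi xA; apply/sum_ofP; exists [:: i], (fun=> x).
by split=> [//|j|]; [rewrite inE => /eqP-> | rewrite big_seq1].
Qed.

End SumOf.

Section Coarsening.
Variables (G H : zmodType) (psi : {additive G -> H}).

Section Ring.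
Variable R : gradedRing G.

Definition coarse_component (k : H) : {pred R} :=
  sum_of [pred g | psi g == k] (@component G R).

Lemma coarse_zmod k : zmod_closed (coarse_component k).
Proof. by apply: sum_of_zmod => g; apply: component_zmod. Qed.

Lemma coarse_sum x : x \in sum_of predT coarse_component.
Proof.
have /sum_ofP[s [f [us fs ->]]] := component_sum x.
apply: zmod_closed_sum => [|g gs]; first exact/sum_of_zmod/coarse_zmod.
apply: (@sum_of1 _ _ _ _ (psi g)) => //; apply: (@sum_of1 _ _ _ _ g).
  exact: eqxx.
by have [] := fs g gs.
Qed.

Lemma coarse_indep : independent coarse_component.
Proof.
move=> s f us fs f0.
have /choice[d dP] (k : H) : exists d : seq G * (G -> R), k \in s ->
    [/\ uniq d.1, {in d.1, forall g, psi g = k /\ d.2 g \in component g}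
      & f k = \sum_(g <- d.1) d.2 g].
  have [/fs/sum_ofP[t [e [ut et ->]]]|_] := boolP (k \in s); last first.
    by exists ([::], fun=> 0).
  by exists (t, e) => _; split=> //= g /et[/eqP].
pose t := [seq g | k <- s, g <- (d k).1].
have ut : uniq t.
  apply: allpairs_uniq_dep => // [k /dP[]//|].
  move=> _ _ /allpairsPdep[k [g [ks gk ->]]] /allpairsPdep[k' [g' [ks' gk' ->]]].
  move=> /= eqg; subst g'.
  have [_ /(_ _ gk)[<- _] _] := dP _ ks.
  by have [_ /(_ _ gk')[<- _] _] := dP _ ks'.
have et k : k \in s -> \sum_(g <- (d k).1) (d (psi g)).2 g = f k.
  move=> ks; have [_ dk ->] := dP _ ks.
  by apply: eq_big_seq => g /dk[->].
have tA : {in t, forall g, (d (psi g)).2 g \in component g}.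
  move=> _ /allpairsPdep[k [g [ks gk ->]]].
  by have [_ /(_ _ gk)[-> ]] := dP _ ks.
have t0 : \sum_(g <- t) (d (psi g)).2 g = 0.
  by rewrite big_allpairs_dep -[RHS]f0; apply: eq_big_seq.
have F0 := component_indep ut tA t0.
move=> k ks; rewrite -et // big_seq big1 // => g gk.
by apply: F0; apply/allpairsPdep; exists k, g.
Qed.

Lemma coarse_mul (k l : H) (x y : R) :
  x \in coarse_component k -> y \in coarse_component l ->
  x * y \in coarse_component (k + l).
Proof.
move=> /sum_ofP[s [f [us fs ->]]] /sum_ofP[t [e [ut et ->]]].
rewrite mulr_suml; apply: zmod_closed_sum => [|g /fs[/eqP <- fg]].
  exact: coarse_zmod.
rewrite mulr_sumr; apply: zmod_closed_sum => [|g' /et[/eqP <- eg]].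
  exact: coarse_zmod.
apply: (@sum_of1 _ _ _ _ (g + g')); first by rewrite /= raddfD.
exact: component_mul.
Qed.

(* The psi-coarsening of R. *)
Definition coarsening : gradedRing H :=
  GradedRing coarse_zmod coarse_sum coarse_indep coarse_mul.

End Ring.

Variables (R S : gradedRing G) (h : gradedHom R S).

Lemma coarse_homP (k : H) (x : coarsening R) :
  x \in component k -> (h x : coarsening S) \in component k.
Proof.
move=> /sum_ofP[s [f [us fs ->]]]; apply/sum_ofP; exists s, (h \o f).
by split=> [//|g /fs[? /(graded_homP h)]//|]; rewrite raddf_sum.
Qed.

(* The psi-coarsening of h. *)
Definition coarsening_hom : gradedHom (coarsening R) (coarsening S) :=
  @GradedHom H (coarsening R) (coarsening S) h coarse_homP.

End Coarsening.

(* Main.v *)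
(* Let T be any commutative ring and T[G] its group ring, G-graded by          *)
(* T[G]_g = T e_g.  A ring morphism u : S -> T, graded or not, induces a       *)
(* morphism of G-graded rings S -> T[G] sending s to the sum of the            *)
(* u(s_g) e_g, from which u is recovered by the augmentation T[G] -> T.        *)
(* Hence an epimorphism of G-graded rings is an epimorphism of rings, and a    *)
(* fortiori of H-graded rings.  Conversely, a pair of morphisms of G-graded    *)
(* rings that agree on the image of h can be compared after coarsening.        *)

From HB Require Import structures.
Require Import Defs.
From mathcomp Require Import all_boot all_algebra.
From mathcomp Require Import boolp finmap monalg.
Set Implicit Arguments.
Unset Strict Implicit.
Unset Printing Implicit Defensive.
Import GRing.Theory.
Local Open Scope ring_scope.

(** A graded epimorphism is already an epimorphism of plain rings ([graded_epi_ring_epi]): two ring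
    morphisms from S to T lift to graded morphisms into T[G] ([gr_lift]), the lifts agree after h
    when the original maps do, and augmentation recovers the original maps ([gr_aug_lift]). This
    gives one direction, since morphisms of H-graded rings are ring morphisms; the other holds
    because coarsening keeps underlying maps. The lift rests on identifying S with the subring of
    S[G] whose coefficient at g lies in S_g: augmentation is bijective there ([homog_aug_inj],
    [homog_aug_surj]). *)

Lemma malg_ind (K : choiceType) (A : zmodType) (P : {malg A[K]} -> Prop) :
  P 0 -> (forall a b, P a -> P b -> P (a + b)) ->
  (forall k x, P << x *g k >>) -> forall a, P a.
Proof. by move=> P0 PD PU a; rewrite (monalgE a); elim/big_ind: _. Qed.

(** * Additive maps out of a direct sum of copies of A *)

Section AdditiveExtension.
Variables (K : choiceType) (A M : zmodType) (phi : K -> A -> M).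
Hypothesis phiD : forall k, {morph phi k : x y / x + y}.

Definition malg_ext (a : {malg A[K]}) : M := \sum_(k <- msupp a) phi k a@_k.

(** Each [phi k] kills 0, so the support may be enlarged; this puts sums over different supports on
    a common index set. *)
Lemma malg_extEw (d : {fset K}) a : (msupp a `<=` d)%fset ->
  malg_ext a = \sum_(k <- d) phi k a@_k.
Proof.
have phi0 k : phi k 0 = 0 by apply: (addrI (phi k 0)); rewrite -phiD !addr0.
move=> ad; apply: big_fset_incl => // k _ /mcoeff_outdom ->; exact: phi0.
Qed.

Lemma malg_extU k x : malg_ext << x *g k >> = phi k x.
Proof. by rewrite (malg_extEw msuppU_le) big_seq_fset1 mcoeffUU. Qed.

Lemma malg_extD : {morph malg_ext : a b / a + b}.
Proof.
move=> a b; rewrite (malg_extEw (msuppD_le a b)).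
rewrite (malg_extEw (fsubsetUl _ (msupp b))) (malg_extEw (fsubsetUr (msupp a) _)).
by rewrite -big_split; apply: eq_bigr => k _; rewrite mcoeffD phiD.
Qed.

Lemma malg_extB : {morph malg_ext : a b / a - b}.
Proof.
move=> a b; apply: (addIr (malg_ext b)).
by rewrite -malg_extD !subrK.
Qed.

Lemma malg_ext0 : malg_ext 0 = 0.
Proof. by apply: (addrI (malg_ext 0)); rewrite -malg_extD !addr0. Qed.

End AdditiveExtension.

(** * The group ring, its grading and its augmentation *)

Section GroupRing.
Variables (G : zmodType) (T : comPzRingType).

(* The library's product on {malg T[G]} needs a monoid G without nontrivial    *)
(* units and a nonzero ring T. *)
Definition group_ring := {malg T[G]}.
HB.instance Definition _ := GRing.Zmodule.on group_ring.

Implicit Types a b c : group_ring.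

Definition gr_mul a b : group_ring :=
  malg_ext (fun g x => malg_ext (fun g' y => << x * y *g g + g' >>) b) a.

Let gr_mulrD (x : T) (g g' : G) :
  {morph (fun y : T => << x * y *g g + g' >>) : y z / y + z}.
Proof. by move=> y z; rewrite mulrDr monalgUD. Qed.

Let gr_mullD b (g : G) : {morph
  (fun x : T => malg_ext (fun g' y => << x * y *g g + g' >>) b) : x y / x + y}.
Proof.
move=> x y; rewrite /malg_ext -big_split; apply: eq_bigr => g' _.
by rewrite mulrDl monalgUD.
Qed.

Lemma gr_mulUU g g' x y :
  gr_mul << x *g g >> << y *g g' >> = << x * y *g g + g' >>.
Proof. by rewrite /gr_mul malg_extU ?malg_extU. Qed.

Lemma gr_mulDl : left_distributive gr_mul +%R.
Proof. by move=> a b c; apply: malg_extD. Qed.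

Lemma gr_mulDr : right_distributive gr_mul +%R.
Proof.
move=> a b c; rewrite /gr_mul -big_split; apply: eq_bigr => g _.
exact: malg_extD.
Qed.

Lemma gr_mul0l b : gr_mul 0 b = 0.
Proof. exact: malg_ext0. Qed.

Lemma gr_mul0r a : gr_mul a 0 = 0.
Proof. by apply: (addrI (gr_mul a 0)); rewrite -gr_mulDr !addr0. Qed.

(** Both sides are additive in each argument, so monomials suffice. *)
Lemma gr_mulA : associative gr_mul.
Proof.
move=> a b c; elim/malg_ind: a => [|a a' IH IH'|g x].
- by rewrite !gr_mul0l.
- by rewrite !gr_mulDl IH IH'.
elim/malg_ind: b => [|b b' IH IH'|g' y].
- by rewrite gr_mul0r !gr_mul0l gr_mul0r.
- by rewrite gr_mulDr !gr_mulDl gr_mulDr IH IH'.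
elim/malg_ind: c => [|c c' IH IH'|g'' z].
- by rewrite !gr_mul0r.
- by rewrite !gr_mulDr IH IH'.
by rewrite !gr_mulUU mulrA addrA.
Qed.

Lemma gr_mulC : commutative gr_mul.
Proof.
move=> a b; elim/malg_ind: a => [|a a' IH IH'|g x].
- by rewrite gr_mul0l gr_mul0r.
- by rewrite gr_mulDl gr_mulDr IH IH'.
elim/malg_ind: b => [|b b' IH IH'|g' y].
- by rewrite gr_mul0l gr_mul0r.
- by rewrite gr_mulDl gr_mulDr IH IH'.
by rewrite !gr_mulUU mulrC addrC.
Qed.

Lemma gr_mul1 : left_id (<< 1 *g 0 >> : group_ring) gr_mul.
Proof.
elim/malg_ind => [|a a' IH IH'|g x].
- exact: gr_mul0r.
- by rewrite gr_mulDr IH IH'.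
by rewrite gr_mulUU mul1r add0r.
Qed.

HB.instance Definition _ := GRing.Zmodule_isComPzRing.Build group_ring
  gr_mulA gr_mulC gr_mul1 gr_mulDl.

Lemma gr_1E : (1 : group_ring) = << 1 *g 0 >>.
Proof. by []. Qed.

Lemma gr_mulUUE g g' x y :
  (<< x *g g >> : group_ring) * << y *g g' >> = << x * y *g g + g' >>.
Proof. exact: gr_mulUU. Qed.

Lemma malg_extM (R : comPzRingType) (phi : G -> T -> R) :
  (forall g, {morph phi g : x y / x + y}) ->
  (forall g g' x y, phi (g + g') (x * y) = phi g x * phi g' y) ->
  {morph malg_ext phi : a b / (a : group_ring) * b >-> a * b}.
Proof.
move=> phiD phiM a b; elim/malg_ind: a => [|a a' IH IH'|g x].
- by rewrite mul0r malg_ext0 // mul0r.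
- by rewrite mulrDl !malg_extD // mulrDl IH IH'.
elim/malg_ind: b => [|b b' IH IH'|g' y].
- by rewrite mulr0 malg_ext0 // mulr0.
- by rewrite mulrDr !malg_extD // mulrDr IH IH'.
by rewrite gr_mulUUE !malg_extU.
Qed.

Definition gr_component (g : G) : {pred group_ring} :=
  [pred a : group_ring | a == << a@_g *g g >>].

Lemma gr_componentU g x : << x *g g >> \in gr_component g.
Proof. by rewrite inE mcoeffUU. Qed.

Lemma gr_component_zmod g : zmod_closed (gr_component g).
Proof.
split=> [|a b]; rewrite !inE ?mcoeff0 ?monalgU0 // => /eqP-> /eqP->.
by rewrite -monalgUB mcoeffUU.
Qed.

Lemma gr_component_sum a : a \in sum_of predT gr_component.
Proof.
apply/sum_ofP; exists (msupp a : seq G), (fun g => << a@_g *g g >>).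
split; [exact: fset_uniq | by move=> g _; split; last exact: gr_componentU |].
exact: monalgE.
Qed.

Lemma gr_component_indep : independent gr_component.
Proof.
move=> s f us fs f0 g gs; move: (fs g gs); rewrite inE => /eqP ->.
suff -> : (f g)@_g = 0 by rewrite monalgU0.
rewrite -(mcoeff0 g) -f0 raddf_sum (bigD1_seq g) //= big_seq_cond big1 ?addr0 //.
move=> g' /andP[/fs]; rewrite inE => /eqP -> g'g.
by rewrite mcoeffU (negPf g'g).
Qed.

Lemma gr_component_mul g g' a b : a \in gr_component g ->
  b \in gr_component g' -> a * b \in gr_component (g + g').
Proof.
by rewrite !inE => /eqP-> /eqP->; rewrite gr_mulUUE mcoeffUU.
Qed.

Definition graded_group_ring : gradedRing G := GradedRing
  gr_component_zmod gr_component_sum gr_component_indep gr_component_mul.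

Definition gr_aug : group_ring -> T := malg_ext (fun _ x => x).

Lemma gr_aug_is_additive : zmod_morphism gr_aug.
Proof. exact: malg_extB. Qed.

Lemma gr_aug_is_multiplicative : monoid_morphism gr_aug.
Proof. by split; [exact: malg_extU | exact: malg_extM]. Qed.

HB.instance Definition _ :=
  GRing.isZmodMorphism.Build group_ring T gr_aug gr_aug_is_additive.
HB.instance Definition _ :=
  GRing.isMonoidMorphism.Build group_ring T gr_aug gr_aug_is_multiplicative.

Lemma gr_augU g x : gr_aug << x *g g >> = x.
Proof. exact: malg_extU. Qed.

Lemma gr_augE a : gr_aug a = \sum_(g <- msupp a) a@_g.
Proof. by []. Qed.

End GroupRing.

(** * Functoriality of the group ring in its coefficients *)

Section GroupRingMap.
Variables (G : zmodType) (A B : comPzRingType) (f : {rmorphism A -> B}).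

Definition gr_map : group_ring G A -> group_ring G B :=
  malg_ext (fun g x => << f x *g g >>).

Let phiD (g : G) : {morph (fun x : A => << f x *g g >>) : x y / x + y}.
Proof. by move=> x y; rewrite rmorphD monalgUD. Qed.

Lemma gr_map_is_additive : zmod_morphism gr_map.
Proof. exact: malg_extB. Qed.

Lemma gr_mapU g x : gr_map << x *g g >> = << f x *g g >>.
Proof. exact: malg_extU. Qed.

Lemma gr_map_is_multiplicative : monoid_morphism gr_map.
Proof.
split; first by rewrite !gr_1E gr_mapU rmorph1.
by apply: malg_extM => // g g' x y; rewrite rmorphM gr_mulUUE.
Qed.

HB.instance Definition _ := GRing.isZmodMorphism.Build
  (group_ring G A) (group_ring G B) gr_map gr_map_is_additive.
HB.instance Definition _ := GRing.isMonoidMorphism.Build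
  (group_ring G A) (group_ring G B) gr_map gr_map_is_multiplicative.

Lemma gr_aug_map a : gr_aug (gr_map a) = f (gr_aug a).
Proof.
elim/malg_ind: a => [|a b IH IH'|g x]; first by rewrite !raddf0.
  by rewrite !raddfD /= IH IH'.
by rewrite gr_mapU !gr_augU.
Qed.

End GroupRingMap.

(** * A graded ring inside its own group ring *)

Section Decomposition.
Variables (G : zmodType) (S : gradedRing G).
Implicit Types (s : S) (a b : group_ring G S).

Definition homog a := forall g, a@_g \in @component G S g.

Lemma component0 g : 0 \in @component G S g.
Proof. by have [] := @component_zmod G S g. Qed.

Lemma homogB a b : homog a -> homog b -> homog (a - b).
Proof.
by move=> ha hb g; rewrite mcoeffB; have [_] := @component_zmod G S g; apply.
Qed.

Lemma homogU g x : x \in @component G S g -> homog << x *g g >>.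
Proof.
by move=> xg g'; rewrite mcoeffU; case: eqP => [<-//|_]; apply: component0.
Qed.

Lemma homog_sum (I : eqType) (r : seq I) (F : I -> group_ring G S) :
  {in r, forall i, homog (F i)} -> homog (\sum_(i <- r) F i).
Proof.
move=> hF g; rewrite raddf_sum.
by apply: zmod_closed_sum => [|i ri]; [exact: component_zmod | exact: hF].
Qed.

Lemma homogM a b : homog a -> homog b -> homog (a * b).
Proof.
move=> ha hb; rewrite (monalgE a) (monalgE b) mulr_suml.
apply: homog_sum => g _; rewrite mulr_sumr; apply: homog_sum => g' _.
by rewrite gr_mulUUE; apply/homogU/component_mul.
Qed.

(** The augmentation of [a - b] is a sum of elements of distinct components, so independence kills
    every coefficient. Identities about [decomp] are thereby checked after augmentation. *)
Lemma homog_aug_inj a b : homog a -> homog b -> gr_aug a = gr_aug b -> a = b.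
Proof.
move=> ha hb eab; apply/eqP; rewrite -subr_eq0; apply/eqP/malgP => g.
rewrite mcoeff0; have [gab|//] := msuppP.
apply: (component_indep (s := msupp (a - b)) (f := fun g => (a - b)@_g)) => //.
- by move=> g' _; apply: homogB.
- by rewrite -gr_augE raddfB /= eab subrr.
Qed.

Lemma homog_aug_surj s : exists a, homog a /\ gr_aug a = s.
Proof.
have /sum_ofP[r [f [_ fr ->]]] := component_sum s.
exists (\sum_(g <- r) << f g *g g >>); split.
  by apply: homog_sum => g /fr[_ fg]; apply: homogU.
by rewrite raddf_sum; apply: eq_bigr => g _; apply: gr_augU.
Qed.

(* s |-> \sum_g s_g e_g, the inverse of the augmentation on the subring of     *)
(* those elements of S[G] whose coefficient at each g lies in S_g.             *)
Definition decomp s : group_ring G S := sval (cid (homog_aug_surj s)).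

Lemma decomp_homog s : homog (decomp s).
Proof. by rewrite /decomp; case: cid => a []. Qed.

Lemma gr_aug_decomp s : gr_aug (decomp s) = s.
Proof. by rewrite /decomp; case: cid => a []. Qed.

Lemma decompU g x : x \in @component G S g -> decomp x = << x *g g >>.
Proof.
move=> xg; apply: homog_aug_inj; [exact: decomp_homog | exact: homogU |].
by rewrite gr_aug_decomp gr_augU.
Qed.

Lemma decomp_is_additive : zmod_morphism decomp.
Proof.
move=> x y; apply: homog_aug_inj; first exact: decomp_homog.
  by apply: homogB; apply: decomp_homog.
by rewrite raddfB /= !gr_aug_decomp.
Qed.

HB.instance Definition _ :=
  GRing.isZmodMorphism.Build S (group_ring G S) decomp decomp_is_additive.

Lemma decompM : {morph decomp : x y / x * y}.
Proof.
move=> x y; apply: homog_aug_inj; first exact: decomp_homog.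
  by apply: homogM; apply: decomp_homog.
by rewrite rmorphM /= !gr_aug_decomp.
Qed.

(* The component e of 1 in degree 0 satisfies e x = x for x homogeneous, hence *)
(* for all x, hence for x = 1. *)
Lemma component1 : 1 \in @component G S 0.
Proof.
have e1 g x : x \in @component G S g -> (decomp 1)@_0 * x = x.
  (* Compare coefficients at g in [decomp x = decomp 1 * decomp x]: the term of [decomp 1] at g'
     lands in degree g' + g, so only g' = 0 contributes. *)
  move=> xg; have := decompM 1 x; rewrite mul1r (decompU xg).
  move=> /(congr1 (mcoeff g)); rewrite mcoeffUU {1}(monalgE (decomp 1)).
  rewrite mulr_suml raddf_sum => {2}->.
  under eq_bigr do rewrite gr_mulUUE /= mcoeffU -subr_eq0 addrK.
  have [d0|d0] := boolP (0 \in msupp (decomp 1)); last first.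
    rewrite (mcoeff_outdom d0) mul0r big_seq big1 // => g' g'd.
    by case: eqP g'd d0 => // -> ->.
  rewrite (big_fsetD1 0) //= eqxx big1_fset ?addr0 // => g'.
  by rewrite in_fsetD1 => /andP[/negPf->].
have -> : 1 = (decomp 1)@_0 :> S; last exact: decomp_homog.
(* Multiply [(decomp 1)@_0] by 1 written as a sum of homogeneous elements, each of which it
   fixes. *)
rewrite -[RHS]mulr1; have /sum_ofP[r [f [_ fr one_f]]] := component_sum (1 : S).
rewrite {1}one_f [X in _ * X]one_f mulr_sumr.
by apply: eq_big_seq => g /fr[_ /e1 ->].
Qed.

Lemma decomp_is_multiplicative : monoid_morphism decomp.
Proof. by split; [rewrite (decompU component1) | exact: decompM]. Qed.

HB.instance Definition _ := GRing.isMonoidMorphism.Build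
  S (group_ring G S) decomp decomp_is_multiplicative.

Variables (T : comPzRingType) (u : {rmorphism S -> T}).

Lemma gr_lift_homP g (s : S) : s \in component g ->
  (gr_map u \o decomp) s \in @component G (graded_group_ring G T) g.
Proof. by move=> sg; rewrite /= (decompU sg) gr_mapU gr_componentU. Qed.

Definition gr_lift : gradedHom S (graded_group_ring G T) :=
  @GradedHom G S (graded_group_ring G T) (gr_map u \o decomp) gr_lift_homP.

Lemma gr_liftU g s : s \in component g -> gr_lift s = << u s *g g >>.
Proof. by move=> sg; rewrite /= (decompU sg) gr_mapU. Qed.

Lemma gr_aug_lift s : gr_aug (gr_lift s) = u s.
Proof. by rewrite /= gr_aug_map gr_aug_decomp. Qed.

End Decomposition.

(** * Comparison of epimorphisms *)

Lemma graded_epi_ring_epi (G : zmodType) (R S : gradedRing G)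
    (h : gradedHom R S) (T : comPzRingType) (u v : {rmorphism S -> T}) :
  graded_epi h -> u \o h =1 v \o h -> u =1 v.
Proof.
move=> h_epi uv s; rewrite -(gr_aug_lift u) -(gr_aug_lift v); congr gr_aug.
apply: (h_epi _ (gr_lift u) (gr_lift v)) => r.
(* By additivity r may be taken homogeneous; h preserves its degree, so both lifts are explicit
   monomials. *)
have /sum_ofP[t [f [_ ft ->]]] := component_sum r.
rewrite !raddf_sum; apply: eq_big_seq => g /ft[_ /(graded_homP h) hg].
by rewrite [LHS](gr_liftU u hg) [RHS](gr_liftU v hg) [u _]uv.
Qed.

Theorem mainTheorem2 (G H : zmodType) (psi : {additive G -> H})
    (psi_epi : group_epi psi) (R S : gradedRing G) (h : gradedHom R S) :
  graded_epi h <-> graded_epi (coarsening_hom psi h).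
Proof.
split=> [h_epi T u v|h_epi T u v uv].
  (* The H-gradings are forgotten: u and v serve as plain ring morphisms. *)
  exact: (@graded_epi_ring_epi G R S h T u v h_epi).
exact: (h_epi _ (coarsening_hom psi u) (coarsening_hom psi v) uv).
Qed.
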